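(* Let $\varphi$ be an endomorphism of a subshift $(X,\sigma)$. There exist $i\in\mathbb N$ and $j\in\mathbb Z$ such that $\varphi^i\sigma^j$ is positively expansive if and only if \[q_R(\varphi)+q_L(\varphi)>0.\] Moreover, for $i\in\mathbb N$ and $j\in\mathbb Z$, $\varphi^i\sigma^j$ is positively expansive if and only if \[-q_R(\varphi)<j/i<q_L(\varphi).\]
   Context: **Subshifts.** $\mathbb N=\{1,2,\dots\}$. An alphabet is a finite set with at least two elements. For an alphabet $A$, $A^{\mathbb Z}$ carries the product topology; the shift maps $(a_j)_j$ to $(a_{j+1})_j$. A subshift $(X,\sigma)$ over $A$ is a closed $X\subset A^{\mathbb Z}$ with $\sigma(X)=X$, $\sigma$ being the restricted shift; $d_X$ is a compatible metric; $L_k(X)$ is the set of words of length $k$ occurring in points of $X$. An endomorphism of $(X,\sigma)$ is a continuous map $\varphi:X\to X$ commuting with $\sigma$ (not assumed onto). A continuous map $\psi:X\to X$ is positively expansive if there is $\delta>0$ such that for $x,y\in X$, $d_X(\psi^i(x),\psi^i(y))\le\delta$ for all $i\ge0$ implies $x=y$. **Type.** A local rule of neighborhood-size $N\ge 0$ on $X$ is a map $f:L_{N+1}(X)\to L_1(X)$ with $(f(a_j\dots a_{j+N}))_{j\in\mathbb Z}\in X$ for all $(a_j)\in X$. For $m,n\ge0$, $m+n=N$, $\varphi$ is of $(m,n)$-type given by $f$ if $\varphi((a_j)_j)=(f(a_{j-m}\dots a_{j+n}))_j$. Every endomorphism arises this way. **$q$-degrees.** A local rule $f$ of neighborhood-size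 $N$ is $k$ right-mergible ($k\ge0$) if for all $(a_j),(b_j)\in X$, $a_j=b_j$ for $j\le 0$ and $f(a_{j-N}\dots a_j)=f(b_{j-N}\dots b_j)$ for $1\le j\le k+1$ imply $a_1=b_1$; $k$ left-mergible if $a_j=b_j$ for $j\ge0$ and $f(a_{-j}\dots a_{-j+N})=f(b_{-j}\dots b_{-j+N})$ for $1\le j\le k+1$ imply $a_{-1}=b_{-1}$. It is strictly $k$ right-mergible if $k\ge 0$ is the least integer for which it is $k$ right-mergible, strictly $\infty$ right-mergible if there is none; similarly for left. If $X$ is infinite and $\varphi$ is of $(m,n)$-type given by $f$ which is strictly $k$ right-mergible and strictly $l$ left-mergible, then $Q_R(\varphi)=n-k$, $Q_L(\varphi)=m-l$; if $X$ is finite, $Q_R(\varphi)=Q_L(\varphi)=\infty$. These are independent of the choice of $f,m,n$. Put $q_R(\varphi)=\lim_{s\to\infty} Q_R(\varphi^s)/s$, $q_L(\varphi)=\lim_{s\to\infty} Q_L(\varphi^s)/s$; these limits exist in $\mathbb R\cup\{\pm\infty\}$, they take the value $\infty$ only when $X$ is finite (in which case both are $\infty$), so the sum $q_R(\varphi)+q_L(\varphi)$ is always defined. *)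

(* Defs.v *)
From HB Require Import structures.
From mathcomp Require Import all_boot all_order all_algebra.
From mathcomp Require Import all_classical all_reals all_analysis.

Set Implicit Arguments.
Unset Strict Implicit.
Unset Printing Implicit Defensive.

Import Order.TTheory GRing.Theory Num.Theory.

Local Open Scope classical_set_scope.
Local Open Scope ring_scope.

Notation full_shift A := {ptws int -> discrete_topology A}.

(** [sigma j] is the [j]-th power of the shift [sigma 1]. *)
Definition sigma (A : finType) (j : int) (a : full_shift A) : full_shift A :=
  fun k => a (k + j).

Definition subshift (A : finType) (X : set (full_shift A)) : Prop :=
  closed X /\ sigma 1 @` X = X.

(** Maps [X -> X] are represented by maps of the full shift, of which only the
    values on [X] matter. *)
Definition endomorphism (A : finType) (X : set (full_shift A))
    (phi : full_shift A -> full_shift A) : Prop :=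
  [/\ forall a, X a -> X (phi a),
      {within X, continuous phi} &
      forall a, X a -> phi (sigma 1 a) = sigma 1 (phi a)].

(** [d] is a metric on [X] inducing the subspace topology; its values outside
    of [X] are irrelevant. *)
Definition compatible_metric (R : realType) (A : finType)
    (X : set (full_shift A)) (d : full_shift A -> full_shift A -> R) : Prop :=
  [/\ forall x y, X x -> X y -> 0 <= d x y,
      forall x y, X x -> X y -> (d x y = 0 <-> x = y),
      forall x y, X x -> X y -> d x y = d y x,
      forall x y z, X x -> X y -> X z -> d x z <= d x y + d y z &
      forall x, X x ->
        within X (nbhs x) =
        filter_from [set e : R | 0 < e] (fun e => X `&` [set y | d x y < e])].

Definition positively_expansive (R : realType) (A : finType)
    (X : set (full_shift A)) (d : full_shift A -> full_shift A -> R)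
    (psi : full_shift A -> full_shift A) : Prop :=
  exists2 delta : R, 0 < delta & forall x y, X x -> X y ->
    (forall n : nat, d (iter n psi x) (iter n psi y) <= delta) -> x = y.

(** The word [a_p a_(p+1) ... a_(p+N)], of length [N + 1]. *)
Definition word (A : finType) (a : full_shift A) (p : int) (N : nat) :
    N.+1.-tuple A :=
  [tuple (a (p + (i : nat)%:Z) : A) | i < N.+1].

(** A local rule is defined on the words of length [N + 1] occurring in [X]; it
    is represented by a function on all words of that length, which is only
    ever evaluated at words occurring in [X]. *)
Definition local_rule (A : finType) (X : set (full_shift A)) (N : nat)
    (f : N.+1.-tuple A -> A) : Prop :=
  forall a, X a -> X (fun j => f (word a j N)).

Definition of_type (A : finType) (X : set (full_shift A))
    (phi : full_shift A -> full_shift A) (m n : nat)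
    (f : (m + n).+1.-tuple A -> A) : Prop :=
  local_rule X f /\
  forall a, X a -> phi a = fun j => f (word a (j - m%:Z) (m + n)).

Definition right_mergible (A : finType) (X : set (full_shift A)) (N : nat)
    (f : N.+1.-tuple A -> A) (k : nat) : Prop :=
  forall a b, X a -> X b ->
    (forall j : int, j <= 0 -> a j = b j) ->
    (forall j : int, 1 <= j <= k%:Z + 1 ->
       f (word a (j - N%:Z) N) = f (word b (j - N%:Z) N)) ->
    a 1 = b 1.

Definition left_mergible (A : finType) (X : set (full_shift A)) (N : nat)
    (f : N.+1.-tuple A -> A) (k : nat) : Prop :=
  forall a b, X a -> X b ->
    (forall j : int, 0 <= j -> a j = b j) ->
    (forall j : int, 1 <= j <= k%:Z + 1 ->
       f (word a (- j) N) = f (word b (- j) N)) ->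
    a (- 1) = b (- 1).

(** [k] is the least natural number satisfying [P], or [+oo] if there is none:
    a local rule [f] is strictly [k] right-mergible on [X] when
    [least (right_mergible X f) k]. *)
Definition least (R : realType) (P : nat -> Prop) (k : \bar R) : Prop :=
  (exists n : nat, [/\ P n, forall n', (n' < n)%N -> ~ P n' & k = n%:R%:E]) \/
  ((forall n, ~ P n) /\ k = +oo%E).

Definition is_right_degree (R : realType) (A : finType)
    (X : set (full_shift A)) (phi : full_shift A -> full_shift A)
    (q : \bar R) : Prop :=
  (finite_set X /\ q = +oo%E) \/
  (infinite_set X /\
   exists (m n : nat) (f : (m + n).+1.-tuple A -> A) (k : \bar R),
     [/\ of_type X phi f, least (right_mergible X f) k & q = (n%:R%:E - k)%E]).

Definition is_left_degree (R : realType) (A : finType)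
    (X : set (full_shift A)) (phi : full_shift A -> full_shift A)
    (q : \bar R) : Prop :=
  (finite_set X /\ q = +oo%E) \/
  (infinite_set X /\
   exists (m n : nat) (f : (m + n).+1.-tuple A -> A) (l : \bar R),
     [/\ of_type X phi f, least (left_mergible X f) l & q = (m%:R%:E - l)%E]).

(** For an endomorphism of a subshift the degree exists and is unique; the
    default value [0] is only taken for other maps. *)
Definition right_degree (R : realType) (A : finType)
    (X : set (full_shift A)) (phi : full_shift A -> full_shift A) : \bar R :=
  xget 0%E [set q | is_right_degree X phi q].

Definition left_degree (R : realType) (A : finType)
    (X : set (full_shift A)) (phi : full_shift A -> full_shift A) : \bar R :=
  xget 0%E [set q | is_left_degree X phi q].

Definition q_right (R : realType) (A : finType)
    (X : set (full_shift A)) (phi : full_shift A -> full_shift A) : \bar R :=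
  limn (fun s : nat => right_degree R X (iter s phi) * (s%:R^-1)%:E)%E.

Definition q_left (R : realType) (A : finType)
    (X : set (full_shift A)) (phi : full_shift A -> full_shift A) : \bar R :=
  limn (fun s : nat => left_degree R X (iter s phi) * (s%:R^-1)%:E)%E.

(* Main.v *)
Require Import Defs.
From mathcomp Require Import all_boot all_order all_algebra.
From mathcomp Require Import all_classical all_reals all_analysis.
From mathcomp Require Import zify ring lra.

Set Implicit Arguments.
Unset Strict Implicit.
Unset Printing Implicit Defensive.

Import Order.TTheory GRing.Theory Num.Theory.

Local Open Scope classical_set_scope.
Local Open Scope ring_scope.

(** A pair of distinct points of [X] that agree far to the left has a leftmost
    mismatch.  Say that [phi] advances by [q] when it moves the leftmost
    mismatch of every such pair at least [q] places to the left, keeping the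
    images distinct.  Since an endomorphism is a sliding block map,
    [Q_R phi >= q] says just this when [X] is infinite ([mergible_advances]
    and [right_degreeP]), and [Q_L] is the mirror image of [Q_R].

    In this form the algebra of degrees is immediate.  Advances add up under
    composition and [sigma j] advances by [j], or by [- j] on the other side,
    so that [s |-> Q (phi^s)] is superadditive and Fekete's lemma gives [q] as
    the supremum of [Q (phi^s) / s] over [s >= 1].  Hence [- q_R < j / i] holds
    if and only if some power of [psi = phi^i sigma^j] advances by [1], and
    [j / i < q_L] if and only if the same holds on the other side
    ([limn_degree], [exceeds_rateP]).  If [phi] advances by no integer at all,
    compactness gives a mismatched pair with equal images
    ([advances_or_collapse]); then no power of [phi] advances and [q = - oo].

    It remains to see that [psi] is positively expansive if and only if, on
    both sides, one of its powers advances by [1].  Compactness replaces the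
    metric by a finite window: [psi] is expansive when equality of two orbits
    on some [-M, M] at all times forces equality ([positively_expansiveP]).

    If a power [theta] of [psi] advances by [1] on both sides, then, again by
    compactness, the letters of [a] and of [theta a] on a window of bounded
    length determine the letter of [a] next to the window.  So equality of the
    whole [theta]-orbits on a large enough window spreads by one place in both
    directions, and then everywhere ([window_expansive_of_advances]).

    Conversely, if [psi] is expansive for the window [-M, M], there is [S] such
    that agreement on [-M, M] at the times [0, ..., S] gives agreement on
    [-M-1, M+1] at time [0].  Sliding the window up to a leftmost mismatch
    shows that this mismatch has moved left at one of the times [1, ..., S]
    ([mismatch_drops]).  Repeating this, it drifts left with speed at least
    [1 / S], and as one step of [psi] moves it right by a bounded amount only,
    a fixed large power of [psi] advances by [1]
    ([advances_of_window_expansive]).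

    When [X] is finite both limits are [+oo], and every map is positively
    expansive because distinct points stay apart already at time [0]. *)

(** * Superadditive sequences *)

Section Superadditive.
Import numFieldNormedType.Exports.
Context {R : realType} (v : nat -> R).
Hypotheses (v0 : 0 <= v 0%N) (sup : forall m n, v m + v n <= v (m + n)%N).

Lemma superadditive_mul p k : k%:R * v p <= v (k * p)%N.
Proof.
elim: k => [|k IH]; first by rewrite mul0r mul0n.
rewrite mulSn -natr1 mulrDl mul1r addrC; apply: le_trans (sup _ _).
by rewrite lerD2l.
Qed.

(** Divide [n] by [p]: the quotient contributes [p]-fold blocks, and the
    remainder costs an amount independent of [n]. *)
Lemma superadditive_lower p n : (0 < p)%N ->
  n%:R * (v p / p%:R) - (`|v p| + p%:R * `|v 1%N|) <= v n.
Proof.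
move=> p0; set w := v p / p%:R.
have pR : 0 < p%:R :> R by rewrite ltr0n.
have vpE : v p = p%:R * w by rewrite /w mulrC divfK // gt_eqF.
have rp : (n %% p < p)%N by rewrite ltn_mod.
have H1 := superadditive_mul p (n %/ p).
have H2 := superadditive_mul 1 (n %% p).
have := sup (n %/ p * p)%N (n %% p)%N; rewrite -divn_eq.
rewrite muln1 in H2.
have nE : n%:R = (n %/ p)%:R * p%:R + (n %% p)%:R :> R.
  by rewrite [in LHS](divn_eq n p) natrD natrM.
have rR0 : 0 <= (n %% p)%:R :> R by exact: ler0n.
have rRp : (n %% p)%:R <= p%:R :> R by rewrite ler_nat ltnW.
move: H1 H2; rewrite nE vpE normrM gtr0_norm //.
set r := (n %% p)%:R in rR0 rRp *; set k := (n %/ p)%:R.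
have : r * w <= p%:R * `|w|.
  apply: le_trans (ler_norm _) _; rewrite normrM.
  by apply: ler_wpM2r => //; rewrite ger0_norm; lra.
have : r * - v 1%N <= p%:R * `|v 1%N|.
  apply: le_trans (ler_norm _) _; rewrite normrM normrN.
  by apply: ler_wpM2r => //; rewrite ger0_norm; lra.
nra.
Qed.

(** The limit is described by its strict lower bounds, which is the form in
    which the asymptotic degrees get compared with fractions. *)
Lemma fekete (C : R) : (forall n, v n <= n%:R * C) ->
  exists l : R, (fun n => v n / n%:R) @ \oo --> l /\
    forall r, r < l <-> exists2 n, (0 < n)%N & r * n%:R < v n.
Proof.
move=> bnd; pose E := [set v n / n%:R | n in [set n | (0 < n)%N]].
have supE : has_sup E.
  split; first by exists (v 1%N / 1%:R), 1%N.
  exists C => _ [n /= n0 <-].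
  by rewrite ler_pdivrMr ?ltr0n // mulrC.
have ubE n : (0 < n)%N -> v n / n%:R <= reals.sup E.
  by move=> n0; apply: sup_upper_bound => //; exists n.
exists (reals.sup E); split; last first.
  move=> r; split=> [rE|[n n0 rn]].
    have e0 : 0 < reals.sup E - r by rewrite subr_gt0.
    have [_ [n /= n0 <-]] := sup_adherent e0 supE.
    by rewrite subKr ltr_pdivlMr ?ltr0n // => ?; exists n.
  by apply: lt_le_trans (ubE n n0); rewrite ltr_pdivlMr ?ltr0n.
apply/cvgrPdist_le => /= eps eps0.
have e20 : 0 < eps / 2 by rewrite divr_gt0.
have [_ [p /= p0 <-] pE] := sup_adherent e20 supE.
pose D := `|v p| + p%:R * `|v 1%N|.
have D0 : 0 <= D by rewrite addr_ge0 // mulr_ge0.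
near=> n.
have n0 : (0 < n)%N by near: n; exists 1%N.
have nR : 0 < n%:R :> R by rewrite ltr0n.
have Dn : D <= n%:R * (eps / 2).
  by rewrite -ler_pdivrMr //; near: n; exact: nbhs_infty_ger.
rewrite ger0_norm ?subr_ge0 ?ubE //.
have := superadditive_lower n p0; rewrite -/D => low.
have : v p / p%:R - eps / 2 <= v n / n%:R.
  rewrite ler_pdivlMr // mulrBl mulrC (mulrC (eps / 2)).
  by apply: le_trans low; rewrite lerD2l lerN2.
lra.
Unshelve. all: by end_near.
Qed.

End Superadditive.

Section Subshifts.
Context {A : finType}.
Implicit Types (X : set (full_shift A)) (a b x y : full_shift A) (e : int).
Implicit Types phi psi : full_shift A -> full_shift A.

(** * Cylinders and compactness *)

Definition agree (M : nat) a b : Prop :=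
  forall j : int, - M%:Z <= j <= M%:Z -> a j = b j.

Lemma agreeW M N a b : (N <= M)%N -> agree M a b -> agree N a b.
Proof. by move=> NM ab j jN; apply: ab; lia. Qed.

Lemma agree_sym M a b : agree M a b -> agree M b a.
Proof. by move=> ab j /ab. Qed.

Lemma agree_trans M a b c : agree M a b -> agree M b c -> agree M a c.
Proof. by move=> ab bc j jM; rewrite ab ?bc. Qed.

Lemma eq_agree a b : (forall M, agree M a b) -> a = b.
Proof. by move=> ab; apply/funext => j; apply: (ab `|j|%N); lia. Qed.

(** Together with [agree_nbhs]: the cylinders around a point are a neighborhood
    basis, so that topological data turn into finite windows. *)
Lemma nbhs_agree (a : full_shift A) M : nbhs a [set x | agree M a x].
Proof.
have FF : Filter (nbhs a) by exact: nbhs_filter.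
suff coord (j : int) : nbhs a [set x : full_shift A | a j = x j].
  elim: M => [|M IH].
    apply: (filterS _ (coord 0)) => x /= ax j j0.
    by have -> : j = 0 by lia.
  have := @filterI _ _ FF _ _ IH
    (@filterI _ _ FF _ _ (coord (M.+1)%:Z) (coord (- (M.+1)%:Z))).
  apply: (@filterS _ _ FF) => x [/= axM [axl axr]] j jM.
  have [jM'|] := boolP (- M%:Z <= j <= M%:Z); first exact: axM.
  have [->//|] := eqVneq j (M.+1)%:Z => ? ?.
  by have -> : j = - (M.+1)%:Z by lia.
have := @proj_continuous int (fun=> discrete_topology A) j a [set a j].
move=> /(_ (discrete_set1 _)); rewrite nbhs_simpl /=.
by apply: (@filterS _ _ FF) => x /= xa; exact/esym.
Qed.

Lemma agree_nbhs (a : full_shift A) (U : set (full_shift A)) :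
  nbhs a U -> exists M, [set x | agree M a x] `<=` U.
Proof.
pose F : set_system (full_shift A) :=
  filter_from [set: nat] (fun M => [set x | agree M a x]).
have FF : Filter F.
  apply: filter_from_filter; first by exists 0%N.
  move=> M N _ _; exists (maxn M N) => // x /= ax.
  by split; apply: agreeW ax; lia.
suff: F --> a by move=> Fa /Fa [M _ MU]; exists M.
(* The index set has to carry some topology to speak of pointwise limits. *)
apply: (iffRL (@pointwise_cvgP (discrete_topology int) (discrete_topology A)
  F a FF)) => j U' /nbhs_singleton aU'.
by exists `|j|%N => // x /= ax; rewrite -ax //; lia.
Qed.

Lemma closed_compact X : closed X -> compact X.
Proof.
move=> Xcl; apply: (subclosed_compact Xcl _ (@subsetT _ X)).
have := @tychonoff int (fun=> discrete_topology A) (fun=> setT).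
have -> : [set f : forall _ : int, discrete_topology A |
    forall i, [set: discrete_topology A] (f i)] = setT by rewrite eqEsubset.
by apply=> _; exact/finite_compact/finite_finset.
Qed.

(** The form in which compactness of [X] is used throughout: a property with
    counterexamples for every [n] has limit points [a], [b] approximated on each
    window by such counterexamples with [n] as large as desired. *)
Lemma limit_pair X (P : nat -> full_shift A -> full_shift A -> Prop) :
  closed X -> (forall n, exists a b, [/\ X a, X b & P n a b]) ->
  exists a b, [/\ X a, X b & forall M : nat, exists n a' b',
    [/\ (M <= n)%N, X a' /\ X b', P n a' b', agree M a a' & agree M b b']].
Proof.
move=> /closed_compact cX exP.
have /choice[u uP] n : exists ab : full_shift A * full_shift A,
    [/\ X ab.1, X ab.2 & P n ab.1 ab.2].
  by have [a [b abP]] := exP n; exists (a, b).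
have [|[a b] [[/= Xa Xb] ab]] := compact_setX cX cX (F := u @ \oo).
  by exists 0%N => // n _; have [Xu Xv _] := uP n; split.
exists a, b; split=> // M.
have uoo : (u @ \oo) [set u n | n in [set n | (M <= n)%N]].
  by exists M => // n /= Mn; exists n.
have [|_ [[n /= Mn <-] [/= au bu]]] :=
    ab _ ([set x | agree M a x] `*` [set x | agree M b x]) uoo.
  exists ([set x | agree M a x], [set x | agree M b x]) => //=.
  by split; exact: nbhs_agree.
by have [Xu Xv Pu] := uP n; exists n, (u n).1, (u n).2.
Qed.

(** * Endomorphisms as sliding block maps *)

Lemma sigmaD i j a : sigma i (sigma j a) = sigma (i + j) a.
Proof. by apply/funext => k; rewrite /sigma addrA. Qed.

Lemma sigma0 a : sigma 0 a = a.
Proof. by apply/funext => k; rewrite /sigma addr0. Qed.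

Lemma subshift_sigma X j a : subshift X -> X a -> X (sigma j a).
Proof.
move=> [_ XE].
have X1 b : X b -> X (sigma 1 b) by move=> Xb; rewrite -XE; exists b.
have XN b : X b -> X (sigma (- 1) b).
  rewrite -[in X in X -> _]XE => -[c Xc <-].
  by rewrite sigmaD addNr sigma0.
elim/int_rec: j a => [|n IH|n IH] a Xa; first by rewrite sigma0.
  by rewrite intS -sigmaD; apply/X1/IH.
by rewrite intS opprD -sigmaD; apply/XN/IH.
Qed.

Lemma iter_stable X psi n a : (forall a, X a -> X (psi a)) ->
  X a -> X (iter n psi a).
Proof. by move=> Xpsi; elim: n => //= n IH /IH /Xpsi. Qed.

(** Commutation with all powers of the shift reduces the local dependence to
    the coordinate [0]. *)
Definition sliding_block X (M : nat) phi : Prop :=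
  [/\ forall a, X a -> X (phi a),
      forall a j, X a -> phi (sigma j a) = sigma j (phi a) &
      forall a b, X a -> X b -> agree M a b -> phi a 0 = phi b 0].

Lemma sliding_block_at X M phi : subshift X -> sliding_block X M phi ->
  forall a b p, X a -> X b ->
  (forall j, p - M%:Z <= j <= p + M%:Z -> a j = b j) -> phi a p = phi b p.
Proof.
move=> sX [Xphi com blk] a b p Xa Xb ab.
have at0 c : X c -> phi c p = phi (sigma p c) 0.
  by move=> Xc; rewrite com // /sigma add0r.
rewrite !at0 //; apply: blk; [exact: subshift_sigma..|].
by move=> j jM; rewrite /sigma; apply: ab; lia.
Qed.

(** The theorem of Curtis, Hedlund and Lyndon.  Otherwise there would be pairs
    that agree on larger and larger windows with images differing at [0]; they
    accumulate at one point, where [phi] could not be continuous. *)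
Lemma endomorphism_sliding_block X phi :
  subshift X -> endomorphism X phi -> exists M, sliding_block X M phi.
Proof.
move=> sX [Xphi cphi com1].
have com a j : X a -> phi (sigma j a) = sigma j (phi a).
  elim/int_rec: j a => [|n IH|n IH] a Xa; first by rewrite !sigma0.
    rewrite intS -sigmaD com1 ?IH ?sigmaD //.
    exact: subshift_sigma.
  rewrite intS opprD -sigmaD.
  have Xna : X (sigma (- n%:Z) a) by exact: subshift_sigma.
  have := com1 _ (subshift_sigma (- 1) sX Xna).
  rewrite (sigmaD 1 (- 1)) subrr sigma0 IH // => E; rewrite -[RHS]sigmaD E.
  by rewrite [RHS]sigmaD addNr sigma0.
suff [M blk] : exists M : nat, forall a b, X a -> X b -> agree M a b ->
  phi a 0 = phi b 0 by exists M.
apply: contrapT => nblk.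
have [n|a [b [Xa Xb lim]]] := limit_pair
    (P := fun n a b => agree n a b /\ phi a 0 <> phi b 0) sX.1.
  apply: contrapT => nab; apply: nblk; exists n => a b Xa Xb ab.
  by apply: contrapT => ?; apply: nab; exists a, b.
have Eab : a = b.
  apply: eq_agree => M; have [n [a' [b' [Mn _ [ab' _] aa' bb']]]] := lim M.
  exact: agree_trans aa' (agree_trans (agreeW Mn ab') (agree_sym bb')).
subst b.
have : (phi @ nbhs (a : subspace X)) [set y | agree 0 (phi a) y].
  by apply: cphi; exact: nbhs_agree.
rewrite nbhs_simpl /= => nb.
have {nb}/agree_nbhs[M aM] :
    within X (nbhs a) (phi @^-1` [set y | agree 0 (phi a) y]).
  by rewrite (nbhs_subspace_in Xa).
have [n [a' [b' [_ [Xa' Xb'] [_ nphi] aa' ab']]]] := lim M.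
have fix0 c : X c -> agree M a c -> phi c 0 = phi a 0.
  by move=> Xc /aM /(_ Xc) /(_ 0) ->.
by apply: nphi; rewrite !fix0.
Qed.

Lemma sliding_block_comp X M N phi psi : subshift X ->
  sliding_block X M phi -> sliding_block X N psi ->
  sliding_block X (M + N) (phi \o psi).
Proof.
move=> sX [Xphi cphi bphi] spsi; have [Xpsi cpsi _] := spsi; split => /=.
- by move=> a /Xpsi/Xphi.
- by move=> a j Xa; rewrite cpsi // cphi //; exact: Xpsi.
- move=> a b Xa Xb ab; apply: bphi; [exact: Xpsi..|] => j jM.
  by apply: (sliding_block_at sX spsi) => // i ij; apply: ab; lia.
Qed.

Lemma sliding_block_iter X M phi s : subshift X -> sliding_block X M phi ->
  sliding_block X (s * M) (iter s phi).
Proof.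
move=> sX sphi; elim: s => [|s IH]; last first.
  by rewrite mulSn; exact: sliding_block_comp sphi IH.
by split=> //= a b _ _ /(_ 0) ->.
Qed.

Lemma sliding_block_sigma X i : subshift X -> sliding_block X `|i| (sigma i).
Proof.
move=> sX; split=> [a Xa|a j Xa|a b Xa Xb ab]; first exact: subshift_sigma.
  by rewrite !sigmaD addrC.
by rewrite /sigma add0r ab //; lia.
Qed.

(** A sign [e] lets one proof serve both sides: reading a point along
    [j |-> e * j] turns left mergibility into right mergibility. *)
Definition direction (e : int) : Prop := e = 1 \/ e = - 1.

Definition first_mismatch (e : int) a b (t : int) : Prop :=
  (forall j, j < t -> a (e * j) = b (e * j)) /\ a (e * t) <> b (e * t).

Lemma ex_first_mismatch e a b s u :
  (forall j, j < s -> a (e * j) = b (e * j)) -> a (e * u) <> b (e * u) ->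
  exists2 t, s <= t <= u & first_mismatch e a b t.
Proof.
move=> abs abu.
have su : s <= u by rewrite leNgt; apply/negP => /abs.
pose P n := (a (e * (s + n%:Z)) : A) != b (e * (s + n%:Z)).
have exP : exists n, P n.
  by exists `|u - s|%N; apply/eqP; have -> : s + `|u - s|%N%:Z = u by lia.
have [n /eqP Pn nmin] := ex_minnP exP.
exists (s + n%:Z); last split=> // j jn.
  apply/andP; split; first by lia.
  rewrite leNgt; apply/negP => un.
  have /nmin : P `|u - s|%N.
    by apply/eqP; have -> : s + `|u - s|%N%:Z = u by lia.
  lia.
have [js|sj] := ltP j s; first exact: abs.
apply/eqP; rewrite -[_ == _]negbK; apply/negP => Pj.
have /nmin : P `|j - s|%N by rewrite /P; have -> : s + `|j - s|%N%:Z = j by lia.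
lia.
Qed.

Lemma first_mismatch_sigma e a b t i : direction e ->
  first_mismatch e a b t ->
  first_mismatch e (sigma i a) (sigma i b) (t - e * i).
Proof.
move=> de [abt nabt]; rewrite /sigma; split=> [j jt|].
  have -> : e * j + i = e * (j + e * i) by case: de => ->; ring.
  by apply: abt; lia.
by have -> : e * (t - e * i) + i = e * t by case: de => ->; ring.
Qed.

(** For infinite [X] this is the inequality [Q_R phi >= q] if [e = 1], and
    [Q_L phi >= q] if [e = - 1], freed from the local rule and its
    neighborhood. *)
Definition advances X e phi (q : int) : Prop :=
  forall a b t, X a -> X b -> first_mismatch e a b t ->
  exists2 t', t' <= t - q & first_mismatch e (phi a) (phi b) t'.

Lemma advances_le X e phi q r : r <= q -> advances X e phi q ->
  advances X e phi r.
Proof.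
move=> rq adv a b t Xa Xb /(adv _ _ _ Xa Xb)[t' t't fm].
by exists t' => //; lia.
Qed.

Lemma eq_advances X e phi psi q : (forall a, X a -> phi a = psi a) ->
  advances X e phi q -> advances X e psi q.
Proof.
move=> E adv a b t Xa Xb /(adv _ _ _ Xa Xb)[t' t't fm].
by exists t' => //; rewrite -!E.
Qed.

Lemma advances_comp X e phi psi q r : (forall a, X a -> X (psi a)) ->
  advances X e phi q -> advances X e psi r ->
  advances X e (phi \o psi) (q + r).
Proof.
move=> Xpsi advq advr a b t Xa Xb /(advr _ _ _ Xa Xb)[t' t't].
move=> /(advq _ _ _ (Xpsi _ Xa) (Xpsi _ Xb))[t'' t''t' fm].
by exists t'' => //; lia.
Qed.

Lemma advances_iter X e phi q s : (forall a, X a -> X (phi a)) ->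
  advances X e phi q -> advances X e (iter s phi) (s%:Z * q).
Proof.
move=> Xphi adv; elim: s => [|s IH].
  by move=> a b t _ _ fm; exists t => //; lia.
have -> : s.+1%:Z * q = q + s%:Z * q by lia.
by apply: advances_comp adv IH => a; exact: iter_stable.
Qed.

Lemma advances_sigma X e i : direction e -> advances X e (sigma i) (e * i).
Proof.
move=> de a b t _ _ fm; exists (t - e * i) => //.
exact: first_mismatch_sigma.
Qed.

Lemma sliding_first_mismatch X M phi e a b s :
  subshift X -> sliding_block X M phi -> direction e -> X a -> X b ->
  (forall j, j < s -> a (e * j) = b (e * j)) ->
  forall j, j < s - M%:Z -> phi a (e * j) = phi b (e * j).
Proof.
move=> sX sphi de Xa Xb abs j js; apply: (sliding_block_at sX sphi) => // i ij.
have -> : i = e * (e * i) by case: de => ->; ring.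
by apply: abs; case: de ij => ->; lia.
Qed.

(** Shift the pairs whose mismatch is delayed by more than [n] so that it occurs
    at [0].  Their images agree up to [n], hence in the limit everywhere, while
    the mismatch at [0] survives. *)
Lemma advances_or_collapse X M phi e : subshift X -> sliding_block X M phi ->
  direction e -> (forall q, ~ advances X e phi q) ->
  exists a b, [/\ X a, X b, first_mismatch e a b 0 & phi a = phi b].
Proof.
move=> sX sphi de nadv.
have [Xphi cphi _] := sphi.
have [n|a [b [Xa Xb lim]]] := limit_pair (P := fun n a b =>
    first_mismatch e a b 0 /\
    forall j, j <= n%:Z -> phi a (e * j) = phi b (e * j)) sX.1.
  apply: contrapT => nab; apply: (nadv (- n%:Z)) => a b t Xa Xb fm.
  apply: contrapT => nt'; apply: nab.
  exists (sigma (e * t) a), (sigma (e * t) b).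
  split; [exact: subshift_sigma..|split].
    have := first_mismatch_sigma (e * t) de fm.
    by have -> : t - e * (e * t) = 0 by case: de => ->; ring.
  move=> j jn; rewrite !cphi // /sigma -mulrDr.
  apply: contrapT => nphi.
  have [] :=
    ex_first_mismatch (sliding_first_mismatch sX sphi de Xa Xb fm.1) nphi.
  by move=> t' tjt' fm'; apply: nt'; exists t' => //; lia.
exists a, b; split=> //.
- split=> [j j0|].
    have [n [a' [b' [_ _ [[ab' _] _] aa' bb']]]] := lim `|j|%N.
    by rewrite aa' ?bb' ?ab' //; case: de => ->; lia.
  have [n [a' [b' [_ _ [[_ ab'] _] aa' bb']]]] := lim 0%N.
  by rewrite aa' ?bb' //; case: de => ->; lia.
- apply/funext => j.
  have [n [a' [b' [jn [Xa' Xb'] [_ phiab'] aa' bb']]]] := lim (`|j| + M)%N.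
  have -> : phi a j = phi a' j.
    by apply: (sliding_block_at sX sphi) => // i ij; apply: aa'; lia.
  have -> : phi b j = phi b' j.
    by apply: (sliding_block_at sX sphi) => // i ij; apply: bb'; lia.
  have -> : j = e * (e * j) by case: de => ->; ring.
  by apply: phiab'; case: de => ->; lia.
Qed.

Lemma not_advances_iter X M phi e s : subshift X -> sliding_block X M phi ->
  direction e -> (0 < s)%N -> (forall q, ~ advances X e phi q) ->
  forall q, ~ advances X e (iter s phi) q.
Proof.
move=> sX sphi de s0 /(advances_or_collapse sX sphi de)[a [b [Xa Xb fm E]]] q.
move=> /(_ _ _ _ Xa Xb fm)[t' _ [_]]; apply; congr (_ _).
by case: s s0 => // s _; rewrite !iterSr E.
Qed.

(** * Mergibility and the degrees *)

(** If one half of a point determines the next letter, then finitely many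
    letters of that half suffice. *)
Lemma uniform_determinism X e : subshift X -> direction e ->
  (forall a b, X a -> X b -> ~ first_mismatch e a b 0) ->
  exists M : nat, forall a b, X a -> X b ->
    (forall j, - M%:Z <= j < 0 -> a (e * j) = b (e * j)) -> a 0 = b 0.
Proof.
move=> sX de det; apply: contrapT => nM.
have [n|a [b [Xa Xb lim]]] := limit_pair (P := fun n a b => a 0 <> b 0 /\
    forall j, - n%:Z <= j < 0 -> a (e * j) = b (e * j)) sX.1.
  apply: contrapT => nab; apply: nM; exists n => a b Xa Xb ab.
  by apply: contrapT => ab0; apply: nab; exists a, b.
apply: (det _ _ Xa Xb); split=> [j j0|].
  have [n [a' [b' [jn _ [_ ab'] aa' bb']]]] := lim `|j|%N.
  by rewrite aa' ?bb' ?ab' //; case: de => E; rewrite ?E; lia.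
rewrite mulr0; have [n [a' [b' [_ _ [ab' _] aa' bb']]]] := lim 0%N.
by rewrite aa' ?bb'.
Qed.

Lemma determinism_propagates X e M : subshift X -> direction e ->
  (forall a b, X a -> X b ->
    (forall j, - M%:Z <= j < 0 -> a (e * j) = b (e * j)) -> a 0 = b 0) ->
  forall a b p, X a -> X b ->
    (forall j, p - M%:Z <= j < p -> a (e * j) = b (e * j)) ->
    forall j, p - M%:Z <= j -> a (e * j) = b (e * j).
Proof.
move=> sX de det a b p Xa Xb ab.
suff H (k : nat) j : p - M%:Z <= j < p + k%:Z -> a (e * j) = b (e * j).
  by move=> j pj; apply: (H (absz (j - p + 1))); lia.
elim: k j => [|k IH] j jk; first by apply: ab; lia.
have [jk'|kj] := ltP j (p + k%:Z); first by apply: IH; lia.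
have := det (sigma (e * j) a) (sigma (e * j) b).
move=> /(_ (subshift_sigma _ sX Xa) (subshift_sigma _ sX Xb)).
rewrite /sigma !add0r; apply => i iM.
by rewrite -mulrDr; apply: IH; lia.
Qed.

(** If there were no such pair, words of some fixed length [M] would determine
    all letters that follow.  Shifting, there would be at most [#|A| ^ M] words
    of any length, whereas the number of words of a long enough length exceeds
    any bound when [X] is infinite. *)
Lemma ex_first_mismatch0 X e : subshift X -> direction e -> infinite_set X ->
  exists a b, [/\ X a, X b & first_mismatch e a b 0].
Proof.
move=> sX de iX; apply: contrapT => nab.
have [|M /(determinism_propagates sX de) det] := uniform_determinism sX de.
  by move=> a b Xa Xb fm; apply: nab; exists a, b.
have [a0 Xa0] := infinite_setN0 iX.
pose K := #|{ffun 'I_M -> A}|.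
have [B BX KB] := infinite_set_fset K.+1 iX.
pose x (i : 'I_K.+1) : full_shift A := nth a0 (finmap.enum_fset B) i.
have iB (i : 'I_K.+1) : (i < size (finmap.enum_fset B))%N.
  exact: leq_trans (ltn_ord i) KB.
have Xx i : X (x i) by apply: BX; exact: mem_nth.
have xI : injective x.
  move=> i j /eqP; rewrite nth_uniq ?iB // => [/eqP/val_inj//|].
  exact: finmap.fset_uniq.
have /choice[p pP] (ij : 'I_K.+1 * 'I_K.+1) :
    exists p : int, x ij.1 p = x ij.2 p -> ij.1 = ij.2.
  apply: contrapT => np; have np' p : x ij.1 p = x ij.2 p.
    by apply: contrapT => xp; apply: np; exists p => /xp.
  by apply: np; exists 0 => _; apply: xI; apply/funext.
pose L := (\max_ij `|p ij|)%N.
pose w i := [ffun k : 'I_M => x i (e * (- L%:Z - 1 - k%:Z)) : A].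
suff wI : injective w by have := leq_card _ wI; rewrite card_ord ltnn.
move=> i j wij; apply: (pP (i, j)) => /=.
have pL : (`|p (i, j)| <= L)%N by exact: leq_bigmax.
have -> : p (i, j) = e * (e * p (i, j)) by case: de => ->; ring.
apply: (det _ _ (- L%:Z)) => // [k kL|]; last by case: de => ->; lia.
have [h kh] : exists h : nat, k = - L%:Z - 1 - h%:Z.
  by exists (absz (- L%:Z - 1 - k)%R); lia.
have hM : (h < M)%N by lia.
by have /ffunP/(_ (Ordinal hM)) := wij; rewrite !ffunE /= -kh.
Qed.

(** A map of [(m, n)]-type has lag [n] in direction [1] and lag [m] in direction
    [- 1]: the places of the image up to [- n] only read nonpositive places of
    the point. *)
Definition lag X (e : int) phi (n : nat) : Prop := forall a b, X a -> X b ->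
  (forall j, j <= 0 -> a (e * j) = b (e * j)) ->
  forall j, j <= - n%:Z -> phi a (e * j) = phi b (e * j).

(** Mergibility in terms of the images alone: the letter that the local rule
    produces from [a_(j-N) ... a_j] is the one at [j - n] of [phi a]. *)
Definition mergible X (e : int) phi (n k : nat) : Prop :=
  forall a b, X a -> X b ->
  (forall j, j <= 0 -> a (e * j) = b (e * j)) ->
  (forall j : int, 1 <= j <= k%:Z + 1 ->
     phi a (e * (j - n%:Z)) = phi b (e * (j - n%:Z))) ->
  a e = b e.

Section Lag.
Context X (e : int) phi (n : nat).
Hypotheses (sX : subshift X) (de : direction e).
Hypothesis cphi : forall a j, X a -> phi (sigma j a) = sigma j (phi a).
Hypothesis lphi : lag X e phi n.

(** For points that agree on the nonpositive places the images agree up to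
    [- n] anyway, so that the [k + 1] equations of mergibility extend this
    agreement up to [k + 1 - n]. *)
Lemma mergible_advances k :
  mergible X e phi n k <-> advances X e phi (n%:Z - k%:Z).
Proof.
split=> [mer a b t Xa Xb fm|adv a b Xa Xb ab0 phiab].
- pose s := e * (t - 1).
  have : ~ (forall j : int, 1 <= j <= k%:Z + 1 ->
     phi (sigma s a) (e * (j - n%:Z)) = phi (sigma s b) (e * (j - n%:Z))).
    move=> /(mer _ _ (subshift_sigma _ sX Xa) (subshift_sigma _ sX Xb)) H.
    apply: fm.2; have := H; rewrite /sigma /s.
    have -> : e + e * (t - 1) = e * t by ring.
    apply=> j j0; rewrite -mulrDr; apply: fm.1; lia.
  move=> /existsNP[j /not_implyP[jk]].
  rewrite !cphi // /sigma -mulrDr => nphi.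
  have [|t' tt' fm'] :=
    @ex_first_mismatch e (phi a) (phi b) (t - n%:Z) _ _ nphi.
    move=> i it; have := @lphi (sigma s a) (sigma s b).
    move=> /(_ (subshift_sigma _ sX Xa) (subshift_sigma _ sX Xb)).
    rewrite !cphi // /sigma => H.
    have -> : e * i = e * (i - t + 1) + s by rewrite /s; ring.
    apply: H; last by lia.
    by move=> h h0; rewrite /s -mulrDr; apply: fm.1; lia.
  by exists t' => //; lia.
- apply: contrapT => ab1.
  have fm : first_mismatch e a b 1.
    by split=> [j j1|]; [apply: ab0; lia | rewrite mulr1].
  have [t' t'1 [_]] := adv _ _ _ Xa Xb fm; apply.
  have [nt|tn] := leP t' (- n%:Z); first exact: lphi.
  by have := phiab (t' + n%:Z); rewrite addrK; apply; lia.
Qed.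

(** This is where [X] has to be infinite: it bounds [Q_R] by [n], so that the
    least [k >= 0] in the definition of the degree is not a truncation. *)
Lemma advances_le_lag q : infinite_set X -> advances X e phi q -> q <= n%:Z.
Proof.
move=> /(ex_first_mismatch0 sX de)[a [b [Xa Xb fm]]] /(_ _ _ _ Xa Xb fm).
move=> [t' t'q [_ nab]]; rewrite leNgt; apply/negP => nq; apply: nab.
pose s := e * - 1.
have := @lphi (sigma s a) (sigma s b).
move=> /(_ (subshift_sigma _ sX Xa) (subshift_sigma _ sX Xb)).
rewrite !cphi // /sigma => H.
have -> : e * t' = e * (t' + 1) + s by rewrite /s; ring.
apply: H; last by lia.
by move=> h h0; rewrite /s -mulrDr; apply: fm.1; lia.
Qed.

End Lag.

(** The degree is the largest [q] by which [phi] advances. *)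
Definition degree_spec (R : realType) X e phi (q : \bar R) : Prop :=
  (exists z : int, q = z%:~R%:E /\ forall r, advances X e phi r <-> r <= z) \/
  (q = -oo%E /\ forall r, ~ advances X e phi r).

Lemma least_mergible_degree (R : realType) X e phi (n : nat) (k : \bar R) :
  subshift X -> direction e -> infinite_set X ->
  (forall a j, X a -> phi (sigma j a) = sigma j (phi a)) ->
  lag X e phi n -> least (mergible X e phi n) k ->
  degree_spec X e phi (n%:R%:E - k)%E.
Proof.
move=> sX de iX cphi lphi.
have merP := mergible_advances sX cphi lphi.
have bnd q := @advances_le_lag X e phi n sX de cphi lphi q iX.
case=> [[k0 [mer nmer ->]]|[nmer ->]].
  left; exists (n%:Z - k0%:Z); split.
    by rewrite -EFinB intrD mulrNz -!pmulrn.
  move=> r; split=> [adv|rk]; last by apply: advances_le rk _; exact/merP.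
  rewrite leNgt; apply/negP => kr.
  have rn := bnd _ adv.
  have : (`|n%:Z - r| < k0)%N by lia.
  move=> /nmer; apply; apply/merP.
  by have -> : n%:Z - `|n%:Z - r|%N%:Z = r by lia.
right; split=> // r adv; have rn := bnd _ adv.
apply: (nmer `|n%:Z - r|%N); apply/merP.
by have -> : n%:Z - `|n%:Z - r|%N%:Z = r by lia.
Qed.

Lemma ex_least (R : realType) (P : nat -> Prop) : exists k : \bar R, least P k.
Proof.
have [[n Pn]|nP] := pselect (exists n, P n); last first.
  by exists +oo%E; right; split=> // n Pn; apply: nP; exists n.
have exP : exists n, `[< P n >] by exists n; exact/asboolP.
have [m /asboolP Pm mmin] := ex_minnP exP.
exists m%:R%:E; left; exists m; split=> // m' m'm Pm'.
by have := mmin m' (introT (asboolP _) Pm'); rewrite leqNgt m'm.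
Qed.

Lemma sub_least (R : realType) (P Q : nat -> Prop) (k : \bar R) :
  (forall n, P n <-> Q n) -> least P k -> least Q k.
Proof.
move=> PQ; have -> // : P = Q.
by apply/funext => n; exact/propext.
Qed.

Lemma word_eq a b p q N :
  (forall i, 0 <= i <= N%:Z -> a (p + i) = b (q + i)) ->
  word a p N = word b q N.
Proof.
move=> ab; apply: eq_from_tnth => i; rewrite !tnth_mktuple; apply: ab.
by have := ltn_ord i; lia.
Qed.

Section OfType.
Context X phi (m n : nat) (f : (m + n).+1.-tuple A -> A).
Hypothesis tphi : of_type X phi f.

Lemma of_type_word a p : X a -> f (word a p (m + n)) = phi a (p + m%:Z).
Proof. by move=> Xa; rewrite tphi.2 // addrK. Qed.

Lemma right_mergible_of_type k :
  right_mergible X f k <-> mergible X 1 phi n k.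
Proof.
have H a (j : int) : X a ->
    f (word a (j - (m + n)%N%:Z) (m + n)) = phi a (1 * (j - n%:Z)).
  by move=> Xa; rewrite of_type_word //; congr (phi a _); lia.
split=> mer a b Xa Xb ab0 phiab; apply: mer => // j jk.
- by have := ab0 j jk; rewrite !mul1r.
- by rewrite !H //; exact: phiab.
- by rewrite mul1r; exact: ab0.
- by rewrite -!H //; exact: phiab.
Qed.

Lemma left_mergible_of_type k :
  left_mergible X f k <-> mergible X (- 1) phi m k.
Proof.
have H a (j : int) : X a ->
    f (word a (- j) (m + n)) = phi a (- 1 * (j - m%:Z)).
  by move=> Xa; rewrite of_type_word //; congr (phi a _); lia.
split=> mer a b Xa Xb ab0 phiab; apply: mer => // j jk.
- by have := ab0 (- j); rewrite mulN1r opprK; apply; lia.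
- by rewrite !H //; exact: phiab.
- by rewrite mulN1r; apply: ab0; lia.
- by rewrite -!H //; exact: phiab.
Qed.

Lemma of_type_lag_right : lag X 1 phi n.
Proof.
move=> a b Xa Xb ab j jn; rewrite !mul1r !tphi.2 //; congr f.
apply: word_eq => i iN; have := ab (j - m%:Z + i).
by rewrite !mul1r; apply; lia.
Qed.

Lemma of_type_lag_left : lag X (- 1) phi m.
Proof.
move=> a b Xa Xb ab j jn; rewrite !tphi.2 //; congr f.
apply: word_eq => i iN; have := ab (- (-1 * j - m%:Z + i)).
by rewrite !mulN1r !opprK; apply; lia.
Qed.

End OfType.

(** The rule picks the common value of [phi] on the points showing the given
    word around [0]. *)
Lemma sliding_block_of_type X M phi : subshift X -> sliding_block X M phi ->
  exists f : (M + M).+1.-tuple A -> A, of_type X phi f.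
Proof.
move=> sX sphi; have [Xphi cphi blk] := sphi.
have /choice[f fP] (w : (M + M).+1.-tuple A) :
    exists c : A, forall a, X a -> word a (- M%:Z) (M + M) = w -> phi a 0 = c.
  have [[a [Xa <-]]|na] :=
      pselect (exists a, X a /\ word a (- M%:Z) (M + M) = w).
    exists (phi a 0) => b Xb ab; apply: blk => // j jM.
    have [h jh] : exists h : nat, j = - M%:Z + h%:Z.
      by exists (absz (j + M%:Z)); lia.
    have hN : (h < (M + M).+1)%N by lia.
    have := congr1 (fun t => tnth t (Ordinal hN)) ab.
    by rewrite !tnth_mktuple /= -jh => ->.
  (* Words that do not occur in [X] get an arbitrary letter. *)
  by exists (tnth w ord0) => a Xa aw; exfalso; apply: na; exists a.
have phiE a : X a -> phi a = fun j => f (word a (j - M%:Z) (M + M)).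
  move=> Xa; apply/funext => j.
  have -> : phi a j = phi (sigma j a) 0 by rewrite cphi // /sigma add0r.
  apply: fP; first exact: subshift_sigma.
  by apply: word_eq => i iM; rewrite /sigma; congr (a _); lia.
exists f; split=> // a Xa.
have -> : (fun j : int => f (word a j (M + M))) = sigma M%:Z (phi a).
  by apply/funext => j; rewrite /sigma phiE // addrK.
by apply: subshift_sigma => //; exact: Xphi.
Qed.

Section DegreeValue.
Context (R : realType) X (M : nat) phi.
Hypotheses (sX : subshift X) (sphi : sliding_block X M phi).
Hypothesis iX : infinite_set X.

Lemma right_degreeP : degree_spec X 1 phi (right_degree R X phi).
Proof.
have [_ cphi _] := sphi.
have spec q : is_right_degree X phi q -> degree_spec (R := R) X 1 phi q.
  move=> [[]//|[_ [m [n [f [k [tphi lk ->]]]]]]].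
  apply: (least_mergible_degree sX _ iX cphi); first by left.
    exact: of_type_lag_right tphi.
  by apply: sub_least lk; exact: right_mergible_of_type.
have [f tphi] := sliding_block_of_type sX sphi.
have [k lk] := ex_least R (right_mergible X f).
apply: spec; apply: (@xgetPex _ _ [set q | is_right_degree X phi q]).
by exists (M%:R%:E - k)%E; right; split=> //; exists M, M, f, k.
Qed.

Lemma left_degreeP : degree_spec X (- 1) phi (left_degree R X phi).
Proof.
have [_ cphi _] := sphi.
have spec q : is_left_degree X phi q -> degree_spec (R := R) X (- 1) phi q.
  move=> [[]//|[_ [m [n [f [k [tphi lk ->]]]]]]].
  apply: (least_mergible_degree sX _ iX cphi); first by right.
    exact: of_type_lag_left tphi.
  by apply: sub_least lk; exact: left_mergible_of_type.
have [f tphi] := sliding_block_of_type sX sphi.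
have [k lk] := ex_least R (left_mergible X f).
apply: spec; apply: (@xgetPex _ _ [set q | is_left_degree X phi q]).
by exists (M%:R%:E - k)%E; right; split=> //; exists M, M, f, k.
Qed.

End DegreeValue.

(** * Asymptotic degrees *)

(** Since the limit is the supremum of [Q (phi^s) / s], this says that [r] is
    below the asymptotic degree; see [limn_degree]. *)
Definition exceeds_rate (R : realType) X e phi (r : R) : Prop :=
  exists s (z : int), [/\ (0 < s)%N, advances X e (iter s phi) z &
                          r * s%:R < z%:~R].

(** Fekete's lemma applies as soon as [phi] advances by some integer, because
    then so do all its powers; if not, none of the powers advances, and the
    sequence is constantly [- oo] from [s = 1] on. *)
Lemma limn_degree (R : realType) X M e phi (u : nat -> \bar R) :
  subshift X -> sliding_block X M phi -> direction e -> infinite_set X ->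
  (forall s, degree_spec X e (iter s phi) (u s)) ->
  let q := limn (fun s => u s * (s%:R^-1)%:E)%E in
  (q < +oo)%E /\ forall r : R, (r%:E < q)%E <-> exceeds_rate X e phi r.
Proof.
move=> sX sphi de iX spec.
have [Xphi cphi _] := sphi.
have [[z0 adv0]|nadv] := pselect (exists z, advances X e phi z); last first.
  have nadv' z : ~ advances X e phi z by move=> adv; apply: nadv; exists z.
  have -> : limn (fun s => u s * (s%:R^-1)%:E)%E = -oo%E.
    apply: cvg_lim => //; apply: cvg_near_cst; exists 1%N => // s /= s0.
    have nadvs := not_advances_iter sX sphi de s0 nadv'.
    case: (spec s) => [[z [_ zP]]|[-> _]].
      by have /nadvs := (zP z).2 (lexx _).
    by rewrite mulNyr gtr0_sg ?mul1e // invr_gt0 ltr0n.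
  split=> // r; split; first by rewrite ltNge leNye.
  move=> [s [z [s0 adv _]]].
  by case: (not_advances_iter sX sphi de s0 nadv' adv).
have /choice[z zP] s : exists z : int, u s = z%:~R%:E /\
    forall r, advances X e (iter s phi) r <-> r <= z.
  case: (spec s) => [//|[_ nadv]].
  by have := nadv _ (advances_iter s Xphi adv0).
have Xit n a : X a -> X (iter n phi a) by exact: iter_stable.
have z_ge0 : (0 <= z 0%N).
  by apply/(zP 0%N).2 => a b t _ _ fm; exists t => //; lia.
have z_sup m n : z m + z n <= z (m + n)%N.
  apply/(zP _).2; apply: (@eq_advances _ _ (iter m phi \o iter n phi)).
    by move=> a _; rewrite /= iterD.
  by apply: advances_comp; [exact: Xit | exact/(zP m).2 | exact/(zP n).2].
have z_le s : z s <= s%:Z * M%:Z.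
  have ss := sliding_block_iter s sX sphi.
  have [_ cs _] := ss.
  have lag_s : lag X e (iter s phi) (s * M).
    move=> a b Xa Xb ab j jn.
    apply: (sliding_first_mismatch sX ss de Xa Xb (s := 1)); last by lia.
    by move=> i i1; apply: ab; lia.
  have := advances_le_lag sX de cs lag_s iX (((zP s).2 (z s)).2 (lexx _)).
  by rewrite PoszM.
have [||| l [zl lP]] := @fekete R (fun s => (z s)%:~R) _ _ M%:R.
- by rewrite ler0z.
- by move=> m n; rewrite -intrD ler_int.
- by move=> n; rewrite -natrM -[X in _ <= X]/((n * M)%N%:Z%:~R) ler_int PoszM.
have -> : limn (fun s => u s * (s%:R^-1)%:E)%E = l%:E.
  have -> : (fun s => u s * (s%:R^-1)%:E)%E =
      EFin \o (fun s => (z s)%:~R / s%:R).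
    by apply/funext => s; rewrite (zP s).1.
  by apply: cvg_lim => //; apply: cvg_EFin => //; exact: nearW.
split; first exact: ltry.
move=> r; rewrite lte_fin; split=> [/lP[s s0 rs]|[s [y [s0 adv ry]]]].
  by exists s, (z s); split=> //; exact/(zP s).2.
apply/lP; exists s => //; apply: (lt_le_trans ry).
by rewrite ler_int; exact/(zP s).2.
Qed.

(** * Positive expansiveness *)

Section Metric.
Context (R : realType) (X : set (full_shift A)).
Context (d : full_shift A -> full_shift A -> R).
Hypotheses (sX : subshift X) (hd : compatible_metric X d).

Lemma ball_agree x (eps : R) : X x -> 0 < eps ->
  exists M, forall y, X y -> agree M x y -> d x y < eps.
Proof.
move=> Xx eps0; have [_ _ _ _ /(_ x Xx) nE] := hd.
have : within X (nbhs x) (X `&` [set y | d x y < eps]).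
  by rewrite nE; exists eps.
move=> /agree_nbhs[M xM]; exists M => y Xy xy.
by have [] := xM _ xy Xy.
Qed.

(** With [agree_close]: on the compact space [X] every compatible metric defines
    the uniformity of the windows. *)
Lemma close_agree M : exists2 delta : R, 0 < delta &
  forall x y, X x -> X y -> d x y <= delta -> agree M x y.
Proof.
have [_ d0 dC dT _] := hd.
apply: contrapT => ndelta.
have [n|x [y [Xx Xy lim]]] := limit_pair
    (P := fun n x y => d x y <= n.+1%:R^-1 /\ ~ agree M x y) sX.1.
  apply: contrapT => nxy; apply: ndelta; exists n.+1%:R^-1 => // x y Xx Xy dxy.
  by apply: contrapT => nag; apply: nxy; exists x, y.
suff Exy : x = y.
  have [n [x' [y' [_ _ [_ nxy'] xx' yy']]]] := lim M; apply: nxy'.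
  by apply: agree_trans (agree_sym xx') _; rewrite Exy.
apply/(d0 _ _ Xx Xy)/eqP; rewrite eq_le; apply/andP; split; last first.
  by have [dge0 _ _ _ _] := hd; exact: dge0.
apply/ler_addgt0Pl => eps eps0; rewrite addr0.
have e30 : 0 < eps / 3 by rewrite divr_gt0.
have [Mx xM] := ball_agree Xx e30; have [My yM] := ball_agree Xy e30.
have [N N3] : exists N : nat, N.+1%:R^-1 < eps / 3.
  by have [N] := ltr_add_invr e30; rewrite add0r; exists N.
have [n [x' [y' [Nn [Xx' Xy'] [dxy' _] xx' yy']]]] := lim (maxn N (maxn Mx My)).
have h1 : d x x' < eps / 3 by apply: xM => //; apply: agreeW xx'; lia.
have h2 : d y y' < eps / 3 by apply: yM => //; apply: agreeW yy'; lia.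
have h3 : d x' y' < eps / 3.
  apply: le_lt_trans dxy' (le_lt_trans _ N3).
  by rewrite lef_pV2 ?posrE // ler_nat; lia.
have := dT _ _ _ Xx Xx' Xy; have := dT _ _ _ Xx' Xy' Xy.
by rewrite (dC _ _ Xy' Xy); lra.
Qed.

Lemma agree_close (delta : R) : 0 < delta -> exists M,
  forall x y, X x -> X y -> agree M x y -> d x y <= delta.
Proof.
have [_ _ dC dT _] := hd.
move=> delta0; apply: contrapT => nM.
have [n|x [y [Xx Xy lim]]] := limit_pair
    (P := fun n x y => agree n x y /\ delta < d x y) sX.1.
  apply: contrapT => nxy; apply: nM; exists n => x y Xx Xy xyn.
  by rewrite leNgt; apply/negP => dxy; apply: nxy; exists x, y.
have e20 : 0 < delta / 2 by rewrite divr_gt0.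
have [M xM] := ball_agree Xx e20.
have [n [x' [y' [Mn [Xx' Xy'] [/(agreeW Mn) xy' dxy'] xx' _]]]] := lim M.
have h1 := xM _ Xx' xx'.
have h2 := xM _ Xy' (agree_trans xx' xy').
have := dT _ _ _ Xx' Xx Xy'; rewrite (dC _ _ Xx' Xx).
move: dxy' h1 h2; lra.
Qed.

Definition window_expansive psi : Prop := exists M, forall a b, X a -> X b ->
  (forall n, agree M (iter n psi a) (iter n psi b)) -> a = b.

Lemma positively_expansiveP psi : (forall a, X a -> X (psi a)) ->
  positively_expansive X d psi <-> window_expansive psi.
Proof.
move=> Xpsi.
have Xit n a : X a -> X (iter n psi a) by exact: iter_stable.
split=> [[delta delta0 H]|[M H]].
  have [M MP] := agree_close delta0; exists M => a b Xa Xb ab.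
  by apply: H => // n; apply: MP => //; exact: Xit.
have [delta delta0 deltaP] := close_agree M.
exists delta => // a b Xa Xb ab; apply: H => // n.
by apply: deltaP => //; exact: Xit.
Qed.

End Metric.

(** By compactness a limit of counterexamples would agree, together with its
    image, on the whole half-line before a mismatch at [0], whereas the image
    must have a mismatch there. *)
Lemma local_advance X M theta e : subshift X -> sliding_block X M theta ->
  direction e -> advances X e theta 1 ->
  exists N : nat, forall a b, X a -> X b ->
    (forall j, - N%:Z <= j < 0 -> a (e * j) = b (e * j)) ->
    (forall j, - N%:Z <= j < 0 -> theta a (e * j) = theta b (e * j)) ->
    a 0 = b 0.
Proof.
move=> sX stheta de adv; apply: contrapT => nN.
have [n|a [b [Xa Xb lim]]] := limit_pair (P := fun n a b => a 0 <> b 0 /\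
    forall j, - n%:Z <= j < 0 ->
      a (e * j) = b (e * j) /\ theta a (e * j) = theta b (e * j)) sX.1.
  apply: contrapT => nab; apply: nN; exists n => a b Xa Xb ab tab.
  apply: contrapT => ab0; apply: nab; exists a, b; split=> //.
  by split=> // j jn; split; [exact: ab|exact: tab].
have fm : first_mismatch e a b 0.
  split=> [j j0|].
    have [n [a' [b' [jn _ [_ ab'] aa' bb']]]] := lim `|j|%N.
    have jn' : - n%:Z <= j < 0 by lia.
    have [abj _] := ab' j jn'.
    by rewrite aa' ?bb' ?abj //; case: de => E; rewrite ?E; lia.
  rewrite mulr0; have [n [a' [b' [_ _ [ab' _] aa' bb']]]] := lim 0%N.
  by rewrite aa' ?bb'.
have [t t0 [_]] := adv _ _ _ Xa Xb fm; apply.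
have [n [a' [b' [tn [Xa' Xb'] [_ ab'] aa' bb']]]] := lim (`|t| + M)%N.
have tn' : - n%:Z <= t < 0 by lia.
have [_ tabt] := ab' t tn'.
have et : absz (e * t) = absz t by case: de => ->; lia.
have -> : theta a (e * t) = theta a' (e * t).
  by apply: (sliding_block_at sX stheta) => // i ij; apply: aa'; lia.
rewrite tabt; apply/esym.
by apply: (sliding_block_at sX stheta) => // i ij; apply: bb'; lia.
Qed.

Lemma window_expansive_iter X s psi :
  window_expansive X (iter s psi) -> window_expansive X psi.
Proof.
move=> [M H]; exists M => a b Xa Xb ab; apply: H => // n.
by rewrite -!iterM.
Qed.

(** A window [W] long enough for both sides works: whenever the two
    [theta]-orbits agree on [-L, L] for some [L >= W], they agree on
    [-L-1, L+1]. *)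
Lemma window_expansive_of_advances X M theta :
  subshift X -> sliding_block X M theta ->
  (forall e, direction e -> advances X e theta 1) -> window_expansive X theta.
Proof.
move=> sX stheta adv; have [Xt ct _] := stheta.
have Xit n a : X a -> X (iter n theta a) by exact: iter_stable.
have /choice[N NP] e : exists N : nat, direction e -> forall a b, X a -> X b ->
    (forall j, - N%:Z <= j < 0 -> a (e * j) = b (e * j)) ->
    (forall j, - N%:Z <= j < 0 -> theta a (e * j) = theta b (e * j)) ->
    a 0 = b 0.
  have [de|nde] := pselect (direction e); last by exists 0%N.
  by have [N NP] := local_advance sX stheta de (adv e de); exists N.
pose W := maxn (N 1) (N (- 1)).
have grow e p a b : direction e -> X a -> X b ->
    (forall j, p - W%:Z <= j < p -> a (e * j) = b (e * j)) ->
    (forall j, p - W%:Z <= j < p -> theta a (e * j) = theta b (e * j)) ->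
    a (e * p) = b (e * p).
  move=> de Xa Xb ab tab.
  have NW : (N e <= W)%N by rewrite /W; case: de => ->; lia.
  have := NP e de _ _
    (subshift_sigma (e * p) sX Xa) (subshift_sigma (e * p) sX Xb).
  rewrite !ct // /sigma add0r; apply=> j jN; rewrite -mulrDr.
    by apply: ab; lia.
  by apply: tab; lia.
exists W => a b Xa Xb ab; apply: eq_agree => L.
suff H n : agree (W + L) (iter n theta a) (iter n theta b).
  by apply: agreeW (H 0%N); lia.
elim: L n => [|L IH] n; first by rewrite addn0.
have step e : direction e ->
    iter n theta a (e * (W + L.+1)%N%:Z) = iter n theta b (e * (W + L.+1)%N%:Z).
  move=> de; apply: grow => // [||j jp|j jp]; try exact: Xit.
    by apply: IH; case: de => ->; lia.
  by apply: (IH n.+1); case: de => ->; lia.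
move=> j jL.
have [jL'|] := boolP (- (W + L)%N%:Z <= j <= (W + L)%N%:Z); first exact: IH.
have := step 1 (or_introl erefl); have := step (- 1) (or_intror erefl).
rewrite mul1r mulN1r => sN s1.
have [->//|] := eqVneq j (W + L.+1)%N%:Z => ? ?.
by have -> : j = - (W + L.+1)%N%:Z by lia.
Qed.

(** By compactness finitely many times decide about one more letter on each
    side of the window. *)
Lemma expansive_window_uniform X M N psi : subshift X ->
  sliding_block X N psi ->
  (forall a b, X a -> X b ->
    (forall n, agree M (iter n psi a) (iter n psi b)) -> a = b) ->
  exists S : nat, forall a b, X a -> X b ->
    (forall n, (n <= S)%N -> agree M (iter n psi a) (iter n psi b)) ->
    agree M.+1 a b.
Proof.
move=> sX spsi exp; apply: contrapT => nS.
have [n|a [b [Xa Xb lim]]] := limit_pair (P := fun n a b =>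
    ~ agree M.+1 a b /\
    forall k, (k <= n)%N -> agree M (iter k psi a) (iter k psi b)) sX.1.
  apply: contrapT => nab; apply: nS; exists n => a b Xa Xb ab.
  by apply: contrapT => ab0; apply: nab; exists a, b.
have Eab : a = b.
  apply: exp => // k j jM; have sk := sliding_block_iter k sX spsi.
  have [n [a' [b' [kn [Xa' Xb'] [_ ab'] aa' bb']]]] := lim (M + k * N + k)%N.
  have -> : iter k psi a j = iter k psi a' j.
    by apply: (sliding_block_at sX sk) => // i ij; apply: aa'; lia.
  have -> : iter k psi b j = iter k psi b' j.
    by apply: (sliding_block_at sX sk) => // i ij; apply: bb'; lia.
  by apply: ab'; first lia.
have [n [a' [b' [_ _ [nab' _] aa' bb']]]] := lim M.+1; apply: nab'.
by apply: agree_trans (agree_sym aa') _; rewrite Eab.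
Qed.

(** Slide the window so that it ends just before the mismatch.  If no mismatch
    moved left up to time [S], the orbits would agree on this window up to time
    [S], hence agree at the mismatch itself. *)
Lemma mismatch_drops X M N S psi e : subshift X -> sliding_block X N psi ->
  direction e ->
  (forall a b, X a -> X b ->
    (forall n, (n <= S)%N -> agree M (iter n psi a) (iter n psi b)) ->
    agree M.+1 a b) ->
  forall a b t, X a -> X b -> first_mismatch e a b t ->
  exists n t', [/\ (0 < n <= S)%N, t' < t &
    first_mismatch e (iter n psi a) (iter n psi b) t'].
Proof.
move=> sX spsi de unif a b t Xa Xb fm; apply: contrapT => nn.
have before n : (n <= S)%N ->
    forall j, j < t -> iter n psi a (e * j) = iter n psi b (e * j).
  move=> nS j jt; apply: contrapT => nj.
  have [n0|n0] := posnP n; first by apply: nj; rewrite n0; exact: fm.1.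
  have sn := sliding_block_iter n sX spsi.
  have [t' t'j fm'] :=
    ex_first_mismatch (sliding_first_mismatch sX sn de Xa Xb fm.1) nj.
  by apply: nn; exists n, t'; split=> //; lia.
pose s := e * (t - 1 - M%:Z).
have := unif _ _ (subshift_sigma s sX Xa) (subshift_sigma s sX Xb).
have H n : (n <= S)%N ->
    agree M (iter n psi (sigma s a)) (iter n psi (sigma s b)).
  move=> nS j jM; have [_ cn _] := sliding_block_iter n sX spsi.
  rewrite !cn // /sigma.
  have -> : j + s = e * (e * j + (t - 1 - M%:Z)).
    by rewrite /s; case: de => ->; ring.
  by apply: before => //; case: de => ->; lia.
move=> /(_ H (e * M.+1%:Z)); rewrite /sigma /s -mulrDr.
have -> : M.+1%:Z + (t - 1 - M%:Z) = t by lia.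
by move=> abt; apply: fm.2; apply: abt; case: de => ->; lia.
Qed.

(** A lower bound [- C] for the advance of [psi] controls the time between two
    consecutive drops of the mismatch, and the drops make it move left with
    speed at least [1 / S]. *)
Lemma advances_of_window_expansive X N psi e : subshift X ->
  sliding_block X N psi -> direction e -> window_expansive X psi ->
  exists2 s, (0 < s)%N & advances X e (iter s psi) 1.
Proof.
move=> sX spsi de [M exp]; have [Xpsi cpsi _] := spsi.
have Xit n a : X a -> X (iter n psi a) by exact: iter_stable.
have [S unif] := expansive_window_uniform sX spsi exp.
have drop := mismatch_drops sX spsi de unif.
(* Collapsing a pair would leave it no mismatch to drop later. *)
have [q adv] : exists q, advances X e psi q.
  apply: contrapT => nadv.
  have [|a [b [Xa Xb fm E]]] := advances_or_collapse sX spsi de.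
    by move=> q adv; apply: nadv; exists q.
  have [n [t [/andP[n0 _] _ [_]]]] := drop _ _ _ Xa Xb fm; apply.
  by case: n n0 => // n _; rewrite !iterSr E.
pose C : nat := `|q|%N.
have advC : advances X e psi (- C%:Z) by apply: advances_le adv; lia.
pose K : nat := (S + S * S * C)%N.
(* [K] absorbs the final stretch of fewer than [S] steps. *)
have key T : forall a b t, X a -> X b -> first_mismatch e a b t ->
    exists2 t', S%:Z * t' <= S%:Z * t - T%:Z + K%:Z &
      first_mismatch e (iter T psi a) (iter T psi b) t'.
  elim/ltn_ind: T => T IH a b t Xa Xb fm.
  have [TS|ST] := ltnP T S.
    have [t' t't fm'] := advances_iter T Xpsi advC Xa Xb fm.
    exists t' => //; rewrite /K.
    have : T%:Z * C%:Z <= S%:Z * C%:Z by nia.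
    nia.
  have [n [t1 [/andP[n0 nS] t1t fm1]]] := drop _ _ _ Xa Xb fm.
  have [|t' t't1 fm'] := IH (T - n)%N _ _ _ _ (Xit n _ Xa) (Xit n _ Xb) fm1.
    by lia.
  exists t'; last by move: fm'; rewrite -!iterD subnK //; lia.
  nia.
exists K.+1 => // a b t Xa Xb /(key K.+1 _ _ _ Xa Xb)[t' t't fm'].
by exists t' => //; nia.
Qed.

Lemma iter_comp_sigma X M phi i j s a : subshift X -> sliding_block X M phi ->
  X a -> iter s (iter i phi \o sigma j) a =
         iter (s * i) phi (sigma (s%:Z * j) a).
Proof.
move=> sX sphi Xa; elim: s => [|s IH]; first by rewrite mul0r sigma0.
have [Xsi csi _] := sliding_block_iter (s * i) sX sphi.
rewrite iterS IH /= -csi ?sigmaD; last exact: subshift_sigma.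
by rewrite mulSn iterD; congr (iter i phi (iter _ phi (sigma _ a))); lia.
Qed.

(** On [X] the [s]-th power of [phi^i sigma^j] is [phi^(s i) sigma^(s j)], which
    advances by exactly [e s j] more than [phi^(s i)]. *)
Lemma exceeds_rateP (R : realType) X M phi e i j : subshift X ->
  sliding_block X M phi -> direction e -> (0 < i)%N ->
  exceeds_rate X e phi (- (e * j)%:~R / i%:R : R) <->
  exists2 s, (0 < s)%N & advances X e (iter s (iter i phi \o sigma j)) 1.
Proof.
move=> sX sphi de i0; have [Xphi cphi _] := sphi.
have Xit n a : X a -> X (iter n phi a) by exact: iter_stable.
have iR : 0 < i%:R :> R by rewrite ltr0n.
have rateE s z : (- (e * j)%:~R / i%:R * s%:R < z%:~R :> R) =
                 (- (e * j) * s%:Z < z * i%:Z).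
  rewrite mulrAC ltr_pdivrMr // -mulrNz.
  by rewrite [s%:R]pmulrn [i%:R]pmulrn -!intrM ltr_int.
split=> [[s [z [s0 adv]]]|[s s0 adv]].
  rewrite rateE => zi; exists s => //.
  have advi : advances X e (iter (s * i) phi) (i%:Z * z).
    apply: (@eq_advances _ _ (iter i (iter s phi))).
      by move=> a _; rewrite mulnC iterM.
    by apply: advances_iter adv; exact: Xit.
  have Xs a : X a -> X (sigma (s%:Z * j) a) by exact: subshift_sigma.
  have adv' := advances_comp Xs advi (advances_sigma (s%:Z * j) de).
  apply: eq_advances (advances_le _ adv'); last by lia.
  by move=> a Xa; rewrite (iter_comp_sigma _ _ _ sX sphi).
exists (s * i)%N, (1 - e * (s%:Z * j)); split; first by rewrite muln_gt0 s0.
  have Xs a : X a -> X (sigma (- (s%:Z * j)) a) by exact: subshift_sigma.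
  have advN := advances_comp Xs adv (advances_sigma (- (s%:Z * j)) de).
  apply: eq_advances (advances_le _ advN); last by lia.
  move=> a Xa /=; rewrite (iter_comp_sigma _ _ _ sX sphi).
    by rewrite sigmaD subrr sigma0.
  exact: subshift_sigma.
by rewrite rateE PoszM; nia.
Qed.

End Subshifts.

(** * Finite subshifts *)

Lemma finite_positive_lower_bound (R : realType) (T : choiceType) (E : set T)
    (g : T -> R) : finite_set E -> (forall x, E x -> 0 < g x) ->
  exists2 delta, 0 < delta & forall x, E x -> delta < g x.
Proof.
move=> /finite_seqP[s ->]; elim: s => [_|x s IH g0]; first by exists 1.
have [y ys|delta d0 dP] := IH; first by apply: g0; rewrite /= inE ys orbT.
have gx : 0 < g x by apply: g0; rewrite /= inE eqxx.
exists (Num.min delta (g x / 2)); first by rewrite lt_min d0 divr_gt0.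
move=> y /=; rewrite inE gt_min => /orP[/eqP->|/dP ->//].
by apply/orP; right; lra.
Qed.

Lemma finite_positively_expansive (R : realType) (A : finType)
    (X : set (full_shift A)) (d : full_shift A -> full_shift A -> R) psi :
  compatible_metric X d -> finite_set X -> positively_expansive X d psi.
Proof.
move=> [dge0 d0 _ _ _] fX.
pose E := (X `*` X) `&` [set xy | xy.1 <> xy.2].
have fE : finite_set E.
  by apply: sub_finite_set (finite_setX fX fX) => xy [].
have [[x y] [[/= Xx Xy] xy]|delta delta0 deltaP] :=
    @finite_positive_lower_bound R _ E (fun xy => d xy.1 xy.2) fE.
  rewrite lt_neqAle dge0 // andbT eq_sym; apply/eqP => /(d0 _ _ Xx Xy).
  exact: xy.
exists delta => // x y Xx Xy /(_ 0%N) /= dxy; apply: contrapT => xy.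
by have := deltaP (x, y); rewrite /= ltNge dxy => /(_ (conj (conj Xx Xy) xy)).
Qed.

Section FiniteRates.
Context (R : realType) (A : finType) (X : set (full_shift A)).
Hypothesis fX : finite_set X.

Lemma limn_pinfty_degree (u : nat -> \bar R) : (forall s, u s = +oo%E) ->
  limn (fun s => u s * (s%:R^-1)%:E)%E = +oo%E.
Proof.
move=> uE; apply: cvg_lim => //; apply: cvg_near_cst; exists 1%N => // s /= s0.
by rewrite uE mulyr gtr0_sg ?mul1e // invr_gt0 ltr0n.
Qed.

Lemma finite_q_right phi : q_right R X phi = +oo%E.
Proof.
apply: limn_pinfty_degree => s.
have : is_right_degree X (iter s phi) (right_degree R X (iter s phi)).
  apply: (@xgetPex _ _ [set q | is_right_degree X _ q]).
  by exists +oo%E; left.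
by case=> [[]//|[/(_ fX)]].
Qed.

Lemma finite_q_left phi : q_left R X phi = +oo%E.
Proof.
apply: limn_pinfty_degree => s.
have : is_left_degree X (iter s phi) (left_degree R X (iter s phi)).
  apply: (@xgetPex _ _ [set q | is_left_degree X _ q]).
  by exists +oo%E; left.
by case=> [[]//|[/(_ fX)]].
Qed.

End FiniteRates.

(** * The theorem *)

(** Density of the rationals if both numbers are finite; both sides fail if one
    of them is [- oo]. *)
Lemma fraction_between (R : realType) (q q' : \bar R) :
  (q < +oo)%E -> (q' < +oo)%E ->
  (exists (i : nat) (j : int), (0 < i)%N /\
     (- q < (j%:~R / i%:R)%:E < q')%E) <-> (0 < q + q')%E.
Proof.
move=> qoo q'oo; split=> [[i [j [i0]]]|].
  case: q qoo => [q||]//= _; case: q' q'oo => [q'||]//= _.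
  - by rewrite !lte_fin => /andP[]; lra.
  - by move=> /andP[_]; rewrite ltNge leNye.
case: q qoo => [q||]//= _; case: q' q'oo => [q'||]//= _.
rewrite -EFinD lte_fin => qq'.
have [|r] := @rat_in_itvoo R (- q) q'; first by lra.
rewrite in_itv /= => qr; exists `|denq r|%N, (numq r).
split; first by rewrite absz_gt0 denq_neq0.
have -> : `|denq r|%N%:R = (denq r)%:~R :> R.
  by rewrite pmulrn gez0_abs // ltW ?denq_gt0.
by rewrite !lte_fin.
Qed.

Theorem theorem9p11 (R : realType) (A : finType) (hA : (1 < #|A|)%N)
    (X : set (full_shift A)) (hX : subshift X)
    (d : full_shift A -> full_shift A -> R) (hd : compatible_metric X d)
    (phi : full_shift A -> full_shift A) (hphi : endomorphism X phi) :
  ((exists (i : nat) (j : int),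
      (0 < i)%N /\ positively_expansive X d (iter i phi \o sigma j)) <->
   (0 < q_right R X phi + q_left R X phi)%E) /\
  (forall (i : nat) (j : int), (0 < i)%N ->
     (positively_expansive X d (iter i phi \o sigma j) <->
      (- q_right R X phi < (j%:~R / i%:R)%:E < q_left R X phi)%E)).
Proof.
have [fX|iX] := pselect (finite_set X).
  have exp psi := finite_positively_expansive psi hd fX.
  rewrite finite_q_right // finite_q_left //; split; last first.
    by move=> i j _; split=> // _; rewrite ltNyr ltry.
  by split=> _; [rewrite addye // ltry | exists 1%N, 0].
have [M sphi] := endomorphism_sliding_block hX hphi.
have [qRoo qRP] := limn_degree hX sphi (or_introl erefl) iX
  (fun s => right_degreeP R hX (sliding_block_iter s hX sphi) iX).
have [qLoo qLP] := limn_degree hX sphi (or_intror erefl) iX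
  (fun s => left_degreeP R hX (sliding_block_iter s hX sphi) iX).
rewrite -/(q_right R X phi) in qRoo qRP; rewrite -/(q_left R X phi) in qLoo qLP.
have main i j : (0 < i)%N ->
    (positively_expansive X d (iter i phi \o sigma j) <->
     (- q_right R X phi < (j%:~R / i%:R)%:E < q_left R X phi)%E).
  move=> i0; set psi := iter i phi \o sigma j.
  have spsi : sliding_block X (i * M + `|j|) psi.
    apply: sliding_block_comp => //; first exact: sliding_block_iter.
    exact: sliding_block_sigma.
  have [Xpsi _ _] := spsi.
  have rateR : (- q_right R X phi < (j%:~R / i%:R)%:E)%E <->
      exists2 s, (0 < s)%N & advances X 1 (iter s psi) 1.
    rewrite lteNl -EFinN -mulNr -[j in j%:~R]mul1r.
    apply: iff_trans (qRP _) _.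
    by apply: (exceeds_rateP _ _ hX sphi _ i0); left.
  have rateL : ((j%:~R / i%:R)%:E < q_left R X phi)%E <->
      exists2 s, (0 < s)%N & advances X (- 1) (iter s psi) 1.
    have -> : j%:~R / i%:R = - (- 1 * j)%:~R / i%:R :> R.
      by rewrite mulN1r mulrNz opprK.
    apply: iff_trans (qLP _) _.
    by apply: (exceeds_rateP _ _ hX sphi _ i0); right.
  apply: (iff_trans (positively_expansiveP hX hd Xpsi)); split.
    move=> exp; apply/andP; split.
      by apply/rateR/(advances_of_window_expansive hX spsi _ exp); left.
    by apply/rateL/(advances_of_window_expansive hX spsi _ exp); right.
  move=> /andP[/rateR[s s0 advs] /rateL[t t0 advt]].
  have Xit n a : X a -> X (iter n psi a) by exact: iter_stable.
  (* A common multiple of both exponents advances on both sides. *)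
  apply: (@window_expansive_iter _ _ (s * t)).
  apply: (window_expansive_of_advances hX (sliding_block_iter _ hX spsi)).
  move=> e [] ->.
    apply: (@eq_advances _ _ _ (iter t (iter s psi))).
      by move=> a _; rewrite mulnC iterM.
    by apply: advances_le (advances_iter t (Xit s) advs); lia.
  apply: (@eq_advances _ _ _ (iter s (iter t psi))).
    by move=> a _; rewrite iterM.
  by apply: advances_le (advances_iter s (Xit t) advt); lia.
split=> //; apply: iff_trans (fraction_between qRoo qLoo).
by split=> -[i [j [i0 H]]]; exists i, j; split=> //; apply/(main i j i0).
Qed.
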